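(* Let $0<|q|<1$. Then \[ \sum_{i,j,k\geq0}\frac{(-1)^{j}q^{i+j^{2}+2j+(i+j-k)^{2}}}{(q;q)_{i}(q^{2};q^{2})_{j}(q^{2};q^{2})_{k}} =\frac{(q^{2};q^{2})_{\infty}(q^4;q^4)_\infty^2}{(q;q)_{\infty}^{2}}, \] and \[ \sum_{i,j,k\geq0}\frac{(-1)^{j}q^{j^{2}+j+k}\big(q^{(i+j-k)^{2}}+q^{(i+j-k+1)^{2}}\big)}{(q;q)_{i}(q^{2};q^{2})_{j}(q^{2};q^{2})_{k}} =\frac{(q^{2};q^{2})_{\infty}^7}{(q;q)_{\infty}^{4} (q^4;q^4)_\infty^2}. \]
   Context: For $a\in\mathbb{C}$ and $|p|<1$: $(a;p)_0=1$, $(a;p)_n=\prod_{k=0}^{n-1}(1-ap^k)$, $(a;p)_\infty=\prod_{k\ge0}(1-ap^k)$. *)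

(* Defs.v *)
From mathcomp Require Import all_boot all_order all_algebra.
From mathcomp Require Import finmap.
From mathcomp Require Import all_classical all_reals all_analysis.
From mathcomp Require Import summability.

Set Implicit Arguments.
Unset Strict Implicit.
Unset Printing Implicit Defensive.

Import Order.TTheory GRing.Theory Num.Theory.
Import numFieldNormedType.Exports.

Local Open Scope classical_set_scope.
Local Open Scope ring_scope.

Definition qpoch (K : numFieldType) (a p : K) (n : nat) : K :=
  \prod_(k < n) (1 - a * p ^+ k).

(* [lim] is total; the limit exists for every a when |p| < 1 and K is complete. *)
Definition qpoch_inf (K : numFieldType) (a p : K) : K :=
  lim (qpoch a p n @[n --> \oo]).

(* Unconditional convergence over N^3: the net of partial sums indexed by the
   finite sets of triples (i, j, k), ordered by inclusion, converges to l. *)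
Definition has_sum3 (K : numFieldType) (f : nat -> nat -> nat -> K) (l : K)
    : Prop :=
  partial_sum (fun t : nat * nat * nat => f t.1.1 t.1.2 t.2) A
    @[A --> totally] --> l.

(* Main.v *)
(** Both sums have the form
    [sum (-1)^j q^(j^2+j) / ((q;q)_i (q^2;q^2)_j) * a_k * w (i+j-k)] with
    [a_k = q^k / (q^2;q^2)_k] and [w (-1-x) = w x]: take
    [w x = q^(x^2+x)] for the first one (using [i+j = k + (i+j-k)]) and
    [w x = q^(x^2) + q^((x+1)^2)] for the second one.
    Summing over [i+j = m] first turns the coefficient into the prefix sum
    [a_0 + ... + a_m].  What remains is [sum_(l,k) a_l a_k sum_(m >= l) w (m-k)],
    where the inner sum is [W - Phi (l-k)] with [W = sum_(N >= 0) w N] and [Phi]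
    the primitive of [w]; [Phi] is odd by the symmetry of [w], so it cancels
    under [l <-> k], and the sum equals [W (sum_l a_l)^2].  Euler's identity
    gives [sum_l a_l = (q^2;q^2)_oo / (q;q)_oo], and the two values of [W] are
    special cases of the Jacobi triple product, obtained as the limit of its
    finite form. *)

Require Import Defs.
From mathcomp Require Import all_boot all_order all_algebra.
From mathcomp Require Import finmap.
From mathcomp Require Import all_classical all_reals all_analysis.
From mathcomp Require Import summability.
From mathcomp Require Import complex.
From mathcomp Require Import ring zify.

Set Implicit Arguments.
Unset Strict Implicit.
Unset Printing Implicit Defensive.

Import Order.TTheory GRing.Theory Num.Theory.
Import numFieldNormedType.Exports.

Local Open Scope classical_set_scope.
Local Open Scope ring_scope.
Local Open Scope complex_scope.

(** * Sequences with geometrically small increments *)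

Lemma cvgn_unique (K : numFieldType) (u : nat -> K) (a b : K) :
  u n @[n --> \oo] --> a -> u n @[n --> \oo] --> b -> a = b.
Proof. by move=> ua ub; apply: (cvg_unique (@norm_hausdorff K K)) ua ub. Qed.

(** The lower bound on [phi] covers both truncated shifts [n - k], with [c = k], and faster indices
    such as [n.*2.+1], with [c = 0]. *)
Lemma cvgn_comp (K : numFieldType) (u : nat -> K) (l : K) (phi : nat -> nat) (c : nat) :
  (forall n, (n <= phi n + c)%N) -> u n @[n --> \oo] --> l ->
  u (phi n) @[n --> \oo] --> l.
Proof.
move=> hphi ul; apply: (@cvg_comp _ _ _ phi u _ \oo) ul.
move=> A [N _ hN]; exists (N + c)%N => // n /= hn; apply: hN => /=.
by have := hphi n; lia.
Qed.

(* A weak form of completeness that also forces [r ^+ n] to tend to 0, so that no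
   archimedean assumption is needed; every estimate below is geometric. *)
Definition geom_complete (K : numFieldType) : Prop :=
  forall (u : nat -> K) (C r : K), 0 <= r < 1 ->
    (forall n, `|u n.+1 - u n| <= C * r ^+ n) -> cvg (u n @[n --> \oo]).

(** The powers have geometric increments, so a limit [l] exists; shifting the index gives
    [l = r * l], which forces [l = 0]. *)
Lemma geom_cvg0 (K : numFieldType) (r : K) :
  geom_complete K -> 0 <= r < 1 -> r ^+ n @[n --> \oo] --> (0 : K).
Proof.
move=> cK /[dup] hr /andP[r0 r1].
have cu : cvg (r ^+ n @[n --> \oo]).
  apply: (cK (fun n => r ^+ n) 1 r hr) => n.
  rewrite mul1r exprS -{2}[r ^+ n]mul1r -mulrBl normrM normrX (ger0_norm r0).
  rewrite ler_piMl ?exprn_ge0// distrC ger0_norm ?subr_ge0 ?(ltW r1)//.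
  by rewrite lerBlDr lerDl.
set l := lim _ in cu; rewrite -/l in cu.
have h1 : (r ^+ n.+1 @[n --> \oo]) --> l by rewrite (cvg_shiftS (fun n => r ^+ n)).
have h2 : (r ^+ n.+1 @[n --> \oo]) --> r * l.
  under eq_fun do rewrite exprS.
  exact: (cvgM (cvg_cst r) cu).
have /eqP : l = r * l by apply: (cvg_unique (@norm_hausdorff K K)) h1 h2.
rewrite -subr_eq0 -{1}[l]mul1r -mulrBl mulf_eq0 subr_eq0 gt_eqF//= => /eqP l0.
by move: cu; rewrite l0.
Qed.

Lemma geom_tail (K : numFieldType) (r : K) (m n : nat) : 0 <= r < 1 ->
  \sum_(m <= k < n) r ^+ k <= r ^+ m / (1 - r).
Proof.
move=> /andP[r0 r1]; have r1' : 0 < 1 - r by rewrite subr_gt0.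
have [nm|/ltnW mn] := leqP n m.
  by rewrite big_geq//; apply: divr_ge0; rewrite ?exprn_ge0// ltW.
have -> : \sum_(m <= k < n) r ^+ k = (r ^+ m - r ^+ n) / (1 - r).
  elim: n mn => [|n IH].
    by rewrite leqn0 => /eqP ->; rewrite big_geq// subrr mul0r.
  rewrite leq_eqVlt => /predU1P[<-|]; first by rewrite big_geq// subrr mul0r.
  rewrite ltnS => mn; rewrite big_nat_recr//= IH// exprS; field.
  by rewrite lt0r_neq0.
by rewrite ler_pM2r ?invr_gt0// lerBlDr lerDl exprn_ge0.
Qed.

Lemma geom_sum_le (K : numFieldType) (r : K) (n : nat) : 0 <= r < 1 ->
  \sum_(k < n) r ^+ k <= (1 - r)^-1.
Proof.
move=> hr; rewrite -(big_mkord xpredT (fun k => r ^+ k)).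
by rewrite (le_trans (geom_tail _ _ hr))// mul1r.
Qed.

Lemma geom_small (K : numFieldType) (C r e : K) :
  geom_complete K -> 0 <= r < 1 -> 0 <= C -> 0 < e ->
  \forall n \near \oo, C * r ^+ n <= e.
Proof.
move=> cK hr C0 e0; have /(cvgM (cvg_cst C)) := geom_cvg0 cK hr.
rewrite mulr0 => /cvgrPdist_le /(_ e e0); apply: filterS => n /=.
case/andP: hr => r0 _.
by rewrite sub0r normrN ger0_norm// mulr_ge0 ?exprn_ge0.
Qed.

Lemma cvg_sum_geom (K : numFieldType) (a : nat -> K) (C r : K) :
  geom_complete K -> 0 <= r < 1 -> (forall k, `|a k| <= C * r ^+ k) ->
  exists S : K, \sum_(k < n) a k @[n --> \oo] --> S.
Proof.
move=> cK hr ha.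
have /cvg_ex : cvg ((fun n => \sum_(k < n) a k) @ \oo); last by [].
apply: (cK _ C r hr) => n.
by rewrite big_ord_recr/= [X in `|X - _|]addrC addrK.
Qed.

(** Dominated convergence for sums whose range grows with [n]. The differences [f n k - g k] are cut
    at a fixed index [h]: the tail is at most a geometric tail, uniformly in [n], and the head is a
    fixed finite sum of null sequences. *)
Lemma tannery (K : numFieldType) (f : nat -> nat -> K) (g : nat -> K) (C C' r S : K) :
  geom_complete K -> 0 <= r < 1 ->
  (forall n k, (k <= n)%N -> `|f n k| <= C * r ^+ k) ->
  (forall k, `|g k| <= C' * r ^+ k) ->
  (forall k, f n k @[n --> \oo] --> g k) ->
  \sum_(k < n) g k @[n --> \oo] --> S ->
  \sum_(k < n.+1) f n k @[n --> \oo] --> S.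
Proof.
move=> cK hr hf hg hfg hS.
have /andP[r0 r1] := hr.
have C0 : 0 <= C by have := hf 0%N 0%N isT; rewrite expr0 mulr1; apply: le_trans.
have C'0 : 0 <= C' by have := hg 0%N; rewrite expr0 mulr1; apply: le_trans.
have CC0 : 0 <= C + C' by rewrite addr_ge0.
have hS1 : \sum_(k < n.+1) g k @[n --> \oo] --> S.
  by rewrite (cvg_shiftS (fun n => \sum_(k < n) g k)).
suff h0 : \sum_(k < n.+1) (f n k - g k) @[n --> \oo] --> (0 : K).
  have -> : (fun n => \sum_(k < n.+1) f n k) =
      (fun n => \sum_(k < n.+1) (f n k - g k)) \+ (fun n => \sum_(k < n.+1) g k).
    by apply/funext => n /=; rewrite sumrB subrK.
  by rewrite -[S]add0r; exact: cvgD.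
apply/cvgrPdist_le => e e0.
have e2 : 0 < e / 2 by rewrite divr_gt0.
have r1' : 0 < 1 - r by rewrite subr_gt0.
have [h _ /(_ h (leqnn h)) hh] :
    \forall n \near \oo, ((C + C') / (1 - r)) * r ^+ n <= e / 2.
  by apply: geom_small => //; rewrite mulr_ge0// invr_ge0 ltW.
have hfin : \sum_(k < h) `|f n k - g k| @[n --> \oo] --> (0 : K).
  rewrite [X in _ --> X](_ : (0 : K) = \sum_(k < h) 0); last by rewrite big1.
  apply: cvg_big => [|k _]; first exact: add_continuous.
  have /cvgr_distC_le hd := hfg k.
  apply/cvgrPdist_le => e' e'0; have := hd _ e'0.
  by apply: filterS => n; rewrite sub0r normrN normr_id.
have /cvgr_distC_le /(_ _ e2) hn := hfin.
near=> n.
have hhn : (h <= n.+1)%N by apply: leqW; near: n; exact: nbhs_infty_ge.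
rewrite sub0r normrN.
rewrite -(big_mkord xpredT (fun k => f n k - g k)) (big_cat_nat (leq0n h) hhn)/=.
apply: (le_trans (ler_normD _ _)).
rewrite [leRHS](_ : e = e / 2 + e / 2); last by field.
apply: lerD.
  rewrite big_mkord; apply: (le_trans (ler_norm_sum _ _ _)).
  have : `|\sum_(k < h) `|f n k - g k| - 0| <= e / 2 by near: n.
  by rewrite subr0 ger0_norm// sumr_ge0.
apply: (le_trans (ler_norm_sum _ _ _)).
apply: le_trans hh.
apply: (@le_trans _ _ (\sum_(h <= k < n.+1) (C + C') * r ^+ k)).
  apply: ler_sum_nat => k /andP[_ kn].
  apply: (le_trans (ler_normB _ _)); rewrite mulrDl.
  by apply: lerD; [apply: hf|apply: hg].
rewrite -mulr_sumr [leRHS]mulrAC -[leRHS]mulrA ler_wpM2l//.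
exact: geom_tail.
Unshelve. all: by end_near. Qed.

(** Induction gives the product times [1 - \sum x k] at most 1, and that second factor is at least
    one half. *)
Lemma prod_1D_le2 (K : numFieldType) (x : nat -> K) (n : nat) :
  (forall k, 0 <= x k) -> \sum_(k < n) x k <= 2^-1 ->
  \prod_(k < n) (1 + x k) <= 2.
Proof.
move=> x0 hs.
have hp : 0 <= \prod_(k < n) (1 + x k) by apply: prodr_ge0 => k _; rewrite addr_ge0.
have : \prod_(k < n) (1 + x k) * (1 - \sum_(k < n) x k) <= 1.
  elim: n {hs hp} => [|n IH]; first by rewrite !big_ord0 subr0 mulr1.
  rewrite !big_ord_recr/=; apply: le_trans IH.
  set P := \prod_(k < n) _; set s := \sum_(k < n) _.
  have P0 : 0 <= P by apply: prodr_ge0 => k _; rewrite addr_ge0.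
  have s0 : 0 <= s by apply: sumr_ge0.
  rewrite -mulrA ler_wpM2l// -subr_ge0.
  have -> : 1 - s - (1 + x n) * (1 - (s + x n)) = x n * (s + x n) by ring.
  by rewrite mulr_ge0 ?addr_ge0.
set P := \prod_(k < n) _ in hp *; set s := \sum_(k < n) _ in hs *.
move=> h.
have : P * 2^-1 <= 1.
  apply: le_trans h; rewrite ler_wpM2l//.
  rewrite lerBrDr (le_trans (lerD (lexx _) hs))//.
  by have -> : 2^-1 + 2^-1 = 1 :> K by field.
by rewrite ler_pdivrMr// mul1r.
Qed.

(** Instead of the exponential of the sum, the bound is a constant head of [h] factors times 2,
    where [h] is chosen so that the remaining [x k] sum to at most one half. *)
Lemma prod_1D_bounded (K : numFieldType) (u : nat -> K) (C r : K) :
  geom_complete K -> 0 <= r < 1 -> (forall k, `|u k| <= C * r ^+ k) ->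
  exists2 B : K, 0 <= B & forall n, `|\prod_(k < n) (1 + u k)| <= B.
Proof.
move=> cK hr hu; have /andP[r0 r1] := hr.
have r1' : 0 < 1 - r by rewrite subr_gt0.
have C0 : 0 <= C by have := hu 0%N; rewrite expr0 mulr1; apply: le_trans.
pose x k := C * r ^+ k.
have x0 k : 0 <= x k by rewrite mulr_ge0 ?exprn_ge0.
have [h _ /(_ h (leqnn h)) hh] : \forall n \near \oo, (C / (1 - r)) * r ^+ n <= 2^-1.
  by apply: geom_small => //; rewrite ?mulr_ge0 ?invr_gt0// invr_ge0 ltW.
have P0 n : 0 <= \prod_(k < n) (1 + x k) by apply: prodr_ge0 => k _; rewrite addr_ge0.
exists (\prod_(k < h) (1 + x k) * 2) => [|n]; first by rewrite mulr_ge0.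
apply: (@le_trans _ _ (\prod_(k < n) (1 + x k))).
  rewrite normr_prod; apply: ler_prod => k _; rewrite normr_ge0/=.
  by apply: (le_trans (ler_normD _ _)); rewrite normr1 lerD2l hu.
(* Passing to [h + n] factors, all at least 1, treats [n < h] and [n >= h] alike. *)
apply: (@le_trans _ _ (\prod_(k < h + n) (1 + x k))).
  rewrite addnC big_split_ord/= ler_peMr ?P0//.
  apply: (@le_trans _ _ (\prod_(i < h) 1)); first by rewrite big1.
  by apply: ler_prod => k _; rewrite ler01/= lerDl.
rewrite big_split_ord/= ler_wpM2l ?P0//.
apply: (@prod_1D_le2 _ (fun k => x (h + k)%N)) => //.
apply: le_trans hh; rewrite -mulrA [(1 - r)^-1 * _]mulrC.
under eq_bigr do rewrite /x exprD.
rewrite -!mulr_sumr ler_wpM2l// ler_wpM2l ?exprn_ge0//.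
exact: geom_sum_le.
Qed.

Lemma prod_1D_cvg (K : numFieldType) (u : nat -> K) (C r : K) :
  geom_complete K -> 0 <= r < 1 -> (forall k, `|u k| <= C * r ^+ k) ->
  cvg (\prod_(k < n) (1 + u k) @[n --> \oo]).
Proof.
move=> cK hr hu; have [B B0 hB] := prod_1D_bounded cK hr hu.
apply: (cK _ (B * C) r hr) => n.
rewrite big_ord_recr/= mulrDr mulr1 [X in `|X - _|]addrC addrK normrM -mulrA.
by apply: ler_pM => /=; [exact: normr_ge0|exact: normr_ge0|exact: hB|exact: hu].
Qed.

(** * Finite q-series identities *)

Lemma qpoch0 (K : numFieldType) (a p : K) : qpoch a p 0 = 1.
Proof. by rewrite /qpoch big_ord0. Qed.

Lemma qpochS (K : numFieldType) (a p : K) (n : nat) :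
  qpoch a p n.+1 = qpoch a p n * (1 - a * p ^+ n).
Proof. by rewrite /qpoch big_ord_recr. Qed.

Lemma qpochSl (K : numFieldType) (a p : K) (n : nat) :
  qpoch a p n.+1 = (1 - a) * qpoch (a * p) p n.
Proof.
rewrite /qpoch big_ord_recl/= expr0 mulr1; congr (_ * _).
by apply: eq_bigr => k _; rewrite exprS mulrA.
Qed.

Lemma qpochpS (K : numFieldType) (p : K) (n : nat) :
  qpoch p p n.+1 = qpoch p p n * (1 - p ^+ n.+1).
Proof. by rewrite qpochS exprS. Qed.

Lemma qpoch_double (K : numFieldType) (a p : K) (n : nat) :
  qpoch a p n.*2 = qpoch a (p ^+ 2) n * qpoch (a * p) (p ^+ 2) n.
Proof.
elim: n => [|n IH]; first by rewrite !qpoch0 mulr1.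
rewrite doubleS !qpochS IH.
have -> : p ^+ n.*2.+1 = p * (p ^+ 2) ^+ n by rewrite exprS -mul2n exprM.
have -> : p ^+ n.*2 = (p ^+ 2) ^+ n by rewrite -mul2n exprM.
by ring.
Qed.

Lemma qpoch_sqr (K : numFieldType) (a p : K) (n : nat) :
  qpoch a p n * qpoch (- a) p n = qpoch (a ^+ 2) (p ^+ 2) n.
Proof.
elim: n => [|n IH]; first by rewrite !qpoch0 mulr1.
rewrite !qpochS -IH.
have -> : (p ^+ 2) ^+ n = p ^+ n * p ^+ n by rewrite -exprM mul2n -addnn exprD.
by ring.
Qed.

Lemma qpochpp_neq0 (K : numFieldType) (p : K) (n : nat) :
  (forall n, 1 - p ^+ n.+1 != 0) -> qpoch p p n != 0.
Proof.
by move=> hp; elim: n => [|n IH]; rewrite ?qpoch0 ?oner_neq0// qpochpS mulf_neq0.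
Qed.

(** In the recurrences below a factor such as [1 - p ^+ j] kills the boundary term, which lowers an
    antidiagonal sum from [m.+1] to [m]. *)
Lemma antidiag_shiftl (V : zmodType) (F : nat -> nat -> V) (m : nat) :
  (forall i, F 0%N i = 0) ->
  \sum_(j < m.+2) F j (m.+1 - j)%N = \sum_(j < m.+1) F j.+1 (m - j)%N.
Proof. by move=> F0; rewrite big_ord_recl F0 add0r. Qed.

Lemma antidiag_shiftr (V : zmodType) (F : nat -> nat -> V) (m : nat) :
  (forall j, F j 0%N = 0) ->
  \sum_(j < m.+2) F j (m.+1 - j)%N = \sum_(j < m.+1) F j (m - j).+1.
Proof.
move=> F0; rewrite big_ord_recr/= subnn F0 addr0.
by apply: eq_bigr => j _; rewrite subSn// -ltnS.
Qed.

(* With [p = q ^ 2], so that the exponent [p ^ (j * (j - 1) / 2)] needs no division. *)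
Lemma q_binomial (K : numFieldType) (q x : K) (m : nat) :
  (forall n, 1 - (q ^+ 2) ^+ n.+1 != 0) ->
  qpoch (- x) (q ^+ 2) m / qpoch (q ^+ 2) (q ^+ 2) m =
  \sum_(j < m.+1) q ^+ (j * j.-1) * x ^+ j
     / (qpoch (q ^+ 2) (q ^+ 2) j * qpoch (q ^+ 2) (q ^+ 2) (m - j)%N).
Proof.
move=> hq; have P0 n : qpoch (q ^+ 2) (q ^+ 2) n != 0 by apply: qpochpp_neq0.
pose b j i := q ^+ (j * j.-1) * x ^+ j
     / (qpoch (q ^+ 2) (q ^+ 2) j * qpoch (q ^+ 2) (q ^+ 2) i).
rewrite -[RHS]/(\sum_(j < m.+1) b j (m - j)%N).
elim: m => [|m IH].
  by rewrite !qpoch0 big_ord_recl big_ord0 /b /= !qpoch0 !expr0 !mulr1 addr0.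
apply: (mulfI (hq m)).
transitivity ((1 + x * (q ^+ 2) ^+ m) * \sum_(j < m.+1) b j (m - j)%N).
  rewrite -IH qpochS qpochpS mulNr opprK; field.
  by rewrite P0 hq.
rewrite !mulr_sumr.
(* With [p = q ^ 2], the factor [1 - p ^ (m+1)] is split so that one part cancels the last factor of
   the Pochhammer symbol of index [j], and the other that of index [m + 1 - j]. *)
under [RHS]eq_bigr => j _.
  have -> : 1 - (q ^+ 2) ^+ m.+1 = (1 - (q ^+ 2) ^+ j) * (q ^+ 2) ^+ (m.+1 - j)
     + (1 - (q ^+ 2) ^+ (m.+1 - j)).
    rewrite mulrBl mul1r -exprD subnKC ?leq_ord//; ring.
  rewrite mulrDl; over.
rewrite big_split/=.
rewrite (antidiag_shiftl
  (F := fun j i => (1 - (q ^+ 2) ^+ j) * (q ^+ 2) ^+ i * b j i)); last first.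
  by move=> i; rewrite expr0 subrr !mul0r.
rewrite (antidiag_shiftr (F := fun j i => (1 - (q ^+ 2) ^+ i) * b j i)); last first.
  by move=> i; rewrite expr0 subrr !mul0r.
rewrite -big_split/=; apply: eq_bigr => j _.
have jm : (j <= m)%N by rewrite -ltnS.
have -> : (q ^+ 2) ^+ m = (q ^+ 2) ^+ j * (q ^+ 2) ^+ (m - j) by rewrite -exprD subnKC.
rewrite /b !qpochpS.
have -> : q ^+ (j.+1 * j.+1.-1) = q ^+ (j * j.-1) * (q ^+ 2) ^+ j.
  by rewrite -exprM -exprD; congr (_ ^+ _); case: (nat_of_ord j) => //= k; lia.
rewrite (exprS x).
field.
by rewrite !P0 !hq.
Qed.

(** The [2n + 2] indices are paired by reflection about [n + 1/2], the finite counterpart of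
    [x <-> -1-x] on the integers. *)
Lemma sum_fold (V : zmodType) (F : nat -> V) (n : nat) :
  \sum_(j < (n.*2.+1).+1) F j = \sum_(k < n.+1) (F (n - k)%N + F (n.+1 + k)%N).
Proof.
rewrite big_split/=.
have -> : (n.*2.+2 = n.+1 + n.+1)%N by lia.
rewrite big_split_ord/=; congr (_ + _).
rewrite (reindex_inj rev_ord_inj)/=; apply: eq_bigr => k _.
by congr (F _); rewrite subSS.
Qed.

(* The q-binomial theorem with [2n + 1] factors at [x = y q^(-2n)], the terms of
   index [n - k] and [n + 1 + k] being grouped: they share the same q-binomial. *)
Lemma finite_jacobi (K : numFieldType) (q y : K) (n : nat) :
  q != 0 -> y != 0 -> (forall n, 1 - (q ^+ 2) ^+ n.+1 != 0) ->
  qpoch (- (q ^+ 2 / y)) (q ^+ 2) n * qpoch (- y) (q ^+ 2) n.+1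
    / qpoch (q ^+ 2) (q ^+ 2) n.*2.+1 =
  \sum_(k < n.+1) q ^+ (k * k.+1) * (y ^- k + y ^+ k.+1)
    / (qpoch (q ^+ 2) (q ^+ 2) (n - k)%N * qpoch (q ^+ 2) (q ^+ 2) (n.+1 + k)%N).
Proof.
move=> q0 y0 hq; have P0 n' : qpoch (q ^+ 2) (q ^+ 2) n' != 0 by apply: qpochpp_neq0.
have qn0 m : q ^+ m != 0 by rewrite expf_neq0.
have yn0 m : y ^+ m != 0 by rewrite expf_neq0.
pose x := y / (q ^+ 2) ^+ n.
(* [c] is the product over [k < n] of [q^(2(n-k)) / y], the factors that turn [1 + y q^(-2(n-k))]
   into [1 + q^(2(n-k)) / y]. *)
pose c := q ^+ (n * n.+1) / y ^+ n.
have hprod : c * qpoch (- x) (q ^+ 2) n.*2.+1 =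
    qpoch (- (q ^+ 2 / y)) (q ^+ 2) n * qpoch (- y) (q ^+ 2) n.+1.
  have -> : n.*2.+1 = (n + n.+1)%N by lia.
  rewrite /qpoch big_split_ord/= mulrA; congr (_ * _); last first.
    apply: eq_bigr => k _; rewrite !mulNr.
    by rewrite /x exprD mulrA divfK// expf_neq0.
  rewrite [RHS](reindex_inj rev_ord_inj)/=.
  have -> : c = \prod_(k < n) ((q ^+ 2) ^+ (n - k) / y).
    rewrite /c big_split/= prodr_const card_ord -exprVn; congr (_ * _).
    elim: n {x c} => [|m IHm]; first by rewrite big_ord0.
    rewrite big_ord_recl/= subn0.
    under eq_bigr do rewrite subSS.
    by rewrite -IHm -exprM -exprD; congr (_ ^+ _); lia.
  rewrite -big_split/=; apply: eq_bigr => k _.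
  have h1 : (q ^+ 2) ^+ (n - k) = q ^+ 2 * (q ^+ 2) ^+ (n - k.+1).
    by rewrite -exprS subnSK.
  have h2 : (q ^+ 2) ^+ n = q ^+ 2 * (q ^+ 2) ^+ (n - k.+1) * (q ^+ 2) ^+ k.
    by rewrite -h1 -exprD subnK// ltnW.
  rewrite /x h2 h1.
  have := expf_neq0 (n - k.+1) (qn0 2%N); have := expf_neq0 k (qn0 2%N).
  move: ((q ^+ 2) ^+ (n - k.+1)) ((q ^+ 2) ^+ k) => A B B0 A0.
  by field; rewrite y0 A0 B0.
rewrite -hprod -mulrA q_binomial// mulr_sumr.
rewrite (sum_fold (fun j => c * (q ^+ (j * j.-1) * x ^+ j
    / (qpoch (q ^+ 2) (q ^+ 2) j * qpoch (q ^+ 2) (q ^+ 2) (n.*2.+1 - j)%N)))).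
apply: eq_bigr => k _; have kn : (k <= n)%N by rewrite -ltnS.
have -> : (n.*2.+1 - (n - k) = n.+1 + k)%N by lia.
have -> : (n.*2.+1 - (n.+1 + k) = n - k)%N by lia.
have e1 : c * (q ^+ ((n - k) * (n - k).-1) * x ^+ (n - k)) = q ^+ (k * k.+1) * y ^- k.
  have Q : q ^+ (n * n.+1) * q ^+ ((n - k) * (n - k).-1) =
      q ^+ (k * k.+1) * ((q ^+ 2) ^+ n) ^+ (n - k).
    rewrite -!exprM -!exprD; congr (_ ^+ _).
    move: (subnK kn); move: (n - k)%N (nat_of_ord k) => e i <-.
    by case: e => [|e]/=; nia.
  have Y : y ^+ n = y ^+ (n - k) * y ^+ k by rewrite -exprD subnK.
  rewrite /c /x expr_div_n Y.
  have D0 := expf_neq0 (n - k) (expf_neq0 n (qn0 2%N)).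
  move: Q D0 (yn0 (n - k)%N) (yn0 k).
  move: (q ^+ (n * n.+1)) (q ^+ (_ * _.-1)) (q ^+ (k * k.+1))
    (((q ^+ 2) ^+ n) ^+ (n - k)).
  move=> a b d D Q D0 ye yk.
  transitivity (a * b / (D * y ^+ k)); first by field; rewrite D0 ye yk.
  by rewrite Q; field; rewrite D0 yk.
have e2 : c * (q ^+ ((n.+1 + k) * (n.+1 + k).-1) * x ^+ (n.+1 + k)) =
    q ^+ (k * k.+1) * y ^+ k.+1.
  have Q : q ^+ (n * n.+1) * q ^+ ((n.+1 + k) * (n.+1 + k).-1) =
      q ^+ (k * k.+1) * ((q ^+ 2) ^+ n) ^+ (n.+1 + k).
    by rewrite -!exprM -!exprD; congr (_ ^+ _); rewrite addSn/=; nia.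
  have Y : y ^+ (n.+1 + k) = y ^+ n * y ^+ k.+1 by rewrite -exprD addSnnS.
  rewrite /c /x expr_div_n Y.
  have D0 := expf_neq0 (n.+1 + k) (expf_neq0 n (qn0 2%N)).
  move: Q D0 (yn0 n).
  move: (q ^+ (n * n.+1)) (q ^+ (_ * _.-1)) (q ^+ (k * k.+1))
    (((q ^+ 2) ^+ n) ^+ (n.+1 + k)).
  move=> a b d D Q D0 ye.
  transitivity (a * b * y ^+ k.+1 / D); first by field; rewrite D0 ye.
  by rewrite Q; field.
by rewrite [qpoch _ _ (n.+1 + k) * _]mulrC ![c * (_ / _)]mulrA e1 e2 -mulrDl -mulrDr.
Qed.

(* Coefficientwise form of [(z;q^2)_oo / (z;q)_oo = 1 / (qz;q^2)_oo]. *)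
Lemma qpoch_conv_aux (K : numFieldType) (q : K) (m : nat) :
  (forall n, 1 - q ^+ n.+1 != 0) ->
  \sum_(j < m.+1) (-1) ^+ j * q ^+ (j * j.-1)
     / (qpoch q q (m - j)%N * qpoch (q ^+ 2) (q ^+ 2) j) =
  q ^+ m / qpoch (q ^+ 2) (q ^+ 2) m.
Proof.
move=> hq.
have hq2 n : 1 - (q ^+ 2) ^+ n.+1 != 0 by rewrite -exprM mul2n doubleS hq.
have P0 n : qpoch (q ^+ 2) (q ^+ 2) n != 0 by apply: qpochpp_neq0.
have R0 n : qpoch q q n != 0 by apply: qpochpp_neq0.
pose t j i := (-1) ^+ j * q ^+ (j * j.-1) / (qpoch q q i * qpoch (q ^+ 2) (q ^+ 2) j).
pose d m := \sum_(j < m.+1) t j (m - j)%N.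
rewrite -[LHS]/(d m).
have tl j i : (1 - (q ^+ 2) ^+ j.+1) * t j.+1 i = - (q ^+ 2) ^+ j * t j i.
  rewrite /t qpochpS.
  have -> : q ^+ (j.+1 * j.+1.-1) = q ^+ (j * j.-1) * (q ^+ 2) ^+ j.
    by rewrite -exprM -exprD; congr (_ ^+ _); case: j => //= k; lia.
  by rewrite (exprS (-1)); field; rewrite P0 R0 hq2.
have tr j i : (1 - q ^+ i.+1) * t j i.+1 = t j i.
  by rewrite /t qpochpS; field; rewrite P0 R0 hq.
(* If [d] has generating function [A(z) B(z)] with [A(z) = 1 / (z;q)_oo], then [E] belongs to
   [A(qz) B(z)]; since [A(qz) = (1 - z) A(z)], it is the difference sequence of [d]. *)
pose E m := \sum_(j < m.+1) q ^+ (m - j) * t j (m - j)%N.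
have ES n : E n.+1 = d n.+1 - d n.
  apply/eqP; rewrite eq_sym subr_eq addrC -subr_eq; apply/eqP.
  rewrite /E /d -sumrB.
  under eq_bigr do rewrite -{1}[t _ _]mul1r -mulrBl.
  rewrite (antidiag_shiftr (F := fun j i => (1 - q ^+ i) * t j i)); last first.
    by move=> i; rewrite expr0 subrr mul0r.
  by apply: eq_bigr => j _; rewrite tr.
have dS n : (1 - (q ^+ 2) ^+ n.+1) * d n.+1 = (1 - (q ^+ 2) ^+ n) * d n + q * E n.
  rewrite /d /E !mulr_sumr.
  (* The split used for the q-binomial theorem, with its second part factored further because the
     symbol of index [n + 1 - j] now has base [q]. *)
  under eq_bigr => j _.
    have -> : 1 - (q ^+ 2) ^+ n.+1 = (1 - (q ^+ 2) ^+ j) * (q ^+ 2) ^+ (n.+1 - j)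
       + (1 - q ^+ (n.+1 - j)) * (1 + q ^+ (n.+1 - j)).
      have -> : (q ^+ 2) ^+ n.+1 = (q ^+ 2) ^+ j * (q ^+ 2) ^+ (n.+1 - j).
        by rewrite -exprD subnKC// leq_ord.
      have -> : (q ^+ 2) ^+ (n.+1 - j) = q ^+ (n.+1 - j) * q ^+ (n.+1 - j).
        by rewrite -exprM mul2n -addnn exprD.
      by ring.
    rewrite mulrDl; over.
  rewrite big_split/=.
  rewrite (antidiag_shiftl
    (F := fun j i => (1 - (q ^+ 2) ^+ j) * (q ^+ 2) ^+ i * t j i)); last first.
    by move=> i; rewrite expr0 subrr !mul0r.
  rewrite (antidiag_shiftr
    (F := fun j i => (1 - q ^+ i) * (1 + q ^+ i) * t j i)); last first.
    by move=> i; rewrite expr0 subrr !mul0r.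
  rewrite -!big_split/=; apply: eq_bigr => j _.
  have jn : (j <= n)%N by rewrite -ltnS.
  have -> : (q ^+ 2) ^+ n = (q ^+ 2) ^+ j * (q ^+ 2) ^+ (n - j) by rewrite -exprD subnKC.
  by rewrite mulrAC tl [X in _ + X]mulrAC tr (exprS q (n - j)); ring.
have d0 : d 0%N = 1.
  by rewrite /d big_ord1 /t subnn !qpoch0 mul0n !expr0 !(mulr1, invr1).
(* The two claims go together: the second turns [dS] into the recurrence
   [(1 - q^(2n+2)) d_(n+1) = q d_n], and [ES] carries it from [n] to [n + 1]. *)
have main n : d n = q ^+ n / qpoch (q ^+ 2) (q ^+ 2) n /\
    (1 - (q ^+ 2) ^+ n) * d n + q * E n = q * d n.
  elim: n => [|n [IH1 IH2]].
    rewrite d0 !expr0 qpoch0 invr1 !mulr1; split=> //.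
    by rewrite subrr add0r /E big_ord1 /t subnn !qpoch0 mul0n !expr0 !(mulr1, invr1).
  have h : d n.+1 = q ^+ n.+1 / qpoch (q ^+ 2) (q ^+ 2) n.+1.
    apply: (mulfI (hq2 n)); rewrite dS IH2 IH1 qpochpS (exprS q n); field.
    by rewrite P0 hq2.
  by split=> //; rewrite dS IH2 ES; ring.
by have [] := main m.
Qed.

(* Coefficientwise form of
   [(q^2 z;q^2)_oo / (z;q)_oo = 1 / ((1 - z) (qz;q^2)_oo)]. *)
Lemma qpoch_conv (K : numFieldType) (q : K) (m : nat) :
  (forall n, 1 - q ^+ n.+1 != 0) ->
  \sum_(j < m.+1) (-1) ^+ j * q ^+ (j * j.+1)
     / (qpoch q q (m - j)%N * qpoch (q ^+ 2) (q ^+ 2) j) =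
  \sum_(l < m.+1) q ^+ l / qpoch (q ^+ 2) (q ^+ 2) l.
Proof.
move=> hq.
have hq2 n : 1 - (q ^+ 2) ^+ n.+1 != 0 by rewrite -exprM mul2n doubleS hq.
have P0 n : qpoch (q ^+ 2) (q ^+ 2) n != 0 by apply: qpochpp_neq0.
have R0 n : qpoch q q n != 0 by apply: qpochpp_neq0.
elim: m => [|m IH].
  by rewrite !big_ord1 subnn !qpoch0 mul0n !expr0 !mulr1.
(* The new term on the right is replaced by its alternating sum with exponent [j(j-1)]. Subtracting
   it produces the factor [q^(2j) - 1], which lowers [j] and leaves the sum for [m]. *)
rewrite [RHS]big_ord_recr/= -IH -qpoch_conv_aux//; apply/eqP; rewrite -subr_eq; apply/eqP.
pose t j i := (-1) ^+ j * q ^+ (j * j.-1) / (qpoch q q i * qpoch (q ^+ 2) (q ^+ 2) j).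
transitivity (\sum_(j < m.+2) - ((1 - (q ^+ 2) ^+ j) * t j (m.+1 - j)%N)).
  rewrite -sumrB; apply: eq_bigr => j _; rewrite /t.
  have -> : q ^+ (j * j.+1) = q ^+ (j * j.-1) * (q ^+ 2) ^+ j.
    by rewrite -exprM -exprD; congr (_ ^+ _); case: (nat_of_ord j) => //= k; lia.
  by ring.
rewrite (antidiag_shiftl (F := fun j i => - ((1 - (q ^+ 2) ^+ j) * t j i))); last first.
  by move=> i; rewrite expr0 subrr !mul0r oppr0.
apply: eq_bigr => j _; rewrite /t qpochpS (exprS (-1)) /= mulnC.
by field; rewrite P0 R0 hq2.
Qed.

(** * Infinite q-products *)

Lemma norm_ap_le (K : numFieldType) (a p : K) (n : nat) :
  `|p| < 1 -> `|a * p ^+ n| <= `|a|.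
Proof.
by move=> hp; rewrite normrM normrX ler_piMr// exprn_ile1// ltW.
Qed.

Lemma qfactor_ge (K : numFieldType) (a p : K) (n : nat) :
  `|p| < 1 -> 1 - `|a| <= `|1 - a * p ^+ n|.
Proof.
move=> hp; apply: (@le_trans _ _ (1 - `|a * p ^+ n|)).
  by rewrite lerD2l lerN2 norm_ap_le.
by rewrite -{1}[1 : K]normr1 lerB_dist.
Qed.

Lemma qfactor_neq0 (K : numFieldType) (a p : K) (n : nat) :
  `|a| < 1 -> `|p| < 1 -> 1 - a * p ^+ n != 0.
Proof.
move=> ha hp; rewrite -normr_gt0; apply: lt_le_trans (qfactor_ge a n hp).
by rewrite subr_gt0.
Qed.

Lemma qpoch_neq0 (K : numFieldType) (a p : K) (n : nat) :
  `|a| < 1 -> `|p| < 1 -> qpoch a p n != 0.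
Proof.
by move=> ha hp; apply/prodf_neq0 => k _; apply: qfactor_neq0.
Qed.

(** Writing [1 / (1 - x)] as [1 + x / (1 - x)] makes the results on products of [1 + u k] apply to
    reciprocals. *)
Lemma qpochV (K : numFieldType) (a p : K) (n : nat) :
  `|a| < 1 -> `|p| < 1 ->
  (qpoch a p n)^-1 = \prod_(k < n) (1 + a * p ^+ k / (1 - a * p ^+ k)).
Proof.
move=> ha hp; rewrite /qpoch -prodfV; apply: eq_bigr => k _.
by have := qfactor_neq0 k ha hp => h; field.
Qed.

Lemma qpoch_cvg (K : numFieldType) (a p : K) :
  geom_complete K -> `|p| < 1 -> qpoch a p n @[n --> \oo] --> qpoch_inf a p.
Proof.
move=> cK hp.
apply: (prod_1D_cvg (u := fun k => - (a * p ^+ k)) (C := `|a|) (r := `|p|)) => //.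
  by rewrite normr_ge0.
by move=> k; rewrite normrN normrM normrX.
Qed.

Lemma qpochV_term_le (K : numFieldType) (a p : K) (k : nat) :
  `|a| < 1 -> `|p| < 1 ->
  `|a * p ^+ k / (1 - a * p ^+ k)| <= (1 - `|a|)^-1 * `|p| ^+ k.
Proof.
move=> ha hp; have ha' : 0 < 1 - `|a| by rewrite subr_gt0.
rewrite normrM mulrC normfV; apply: ler_pM => //.
- by rewrite lef_pV2 ?posrE ?normr_gt0 ?qfactor_neq0//; apply: qfactor_ge.
- by rewrite normrM normrX ler_piMl ?exprn_ge0// ltW.
Qed.

Lemma qpochV_bounded (K : numFieldType) (a p : K) :
  geom_complete K -> `|a| < 1 -> `|p| < 1 ->
  exists2 B : K, 0 <= B & forall n, `|(qpoch a p n)^-1| <= B.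
Proof.
move=> cK ha hp.
have [|k|B B0 hB] := @prod_1D_bounded K (fun k => a * p ^+ k / (1 - a * p ^+ k))
  ((1 - `|a|)^-1) `|p| cK.
- by rewrite normr_ge0.
- exact: qpochV_term_le.
by exists B => // n; rewrite qpochV.
Qed.

(** The reciprocals converge too, and the product of the two limits is 1. *)
Lemma qpoch_inf_neq0 (K : numFieldType) (a p : K) :
  geom_complete K -> `|a| < 1 -> `|p| < 1 -> qpoch_inf a p != 0.
Proof.
move=> cK ha hp.
have /cvg_ex[/= l hl] : cvg ((fun n => (qpoch a p n)^-1) @ \oo).
  under eq_fun do rewrite qpochV//.
  apply: (prod_1D_cvg (u := fun k => a * p ^+ k / (1 - a * p ^+ k))
    (C := (1 - `|a|)^-1) (r := `|p|)) => //.
    by rewrite normr_ge0.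
  by move=> k; apply: qpochV_term_le.
have h1 : ((fun n => (qpoch a p n)^-1) \* qpoch a p) @ \oo --> l * qpoch_inf a p.
  by apply: cvgM => //; exact: qpoch_cvg.
have h2 : ((fun n => (qpoch a p n)^-1) \* qpoch a p) @ \oo --> (1 : K).
  rewrite (_ : _ \* _ = fun=> 1); first exact: cvg_cst.
  by apply/funext => n /=; rewrite mulVf// qpoch_neq0.
have h := cvgn_unique h1 h2.
by apply: contra_eq_neq h => ->; rewrite mulr0 eq_sym oner_neq0.
Qed.

Lemma qpoch_inf_double (K : numFieldType) (a p : K) :
  geom_complete K -> `|p| < 1 ->
  qpoch_inf a p = qpoch_inf a (p ^+ 2) * qpoch_inf (a * p) (p ^+ 2).
Proof.
move=> cK hp; have hp2 : `|p ^+ 2| < 1 by rewrite normrX exprn_ilt1.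
have h1 : qpoch a p n.*2 @[n --> \oo] --> qpoch_inf a p.
  by apply: (@cvgn_comp _ _ _ _ 0); [move=> n; lia|exact: qpoch_cvg].
apply: cvgn_unique h1 _; under eq_fun do rewrite qpoch_double.
by apply: cvgM; apply: qpoch_cvg.
Qed.

Lemma qpoch_inf_sqr (K : numFieldType) (a p : K) :
  geom_complete K -> `|p| < 1 ->
  qpoch_inf a p * qpoch_inf (- a) p = qpoch_inf (a ^+ 2) (p ^+ 2).
Proof.
move=> cK hp; have hp2 : `|p ^+ 2| < 1 by rewrite normrX exprn_ilt1.
have h1 := @qpoch_cvg _ (a ^+ 2) _ cK hp2.
apply: cvgn_unique _ h1; under eq_fun do rewrite -qpoch_sqr.
by apply: cvgM; apply: qpoch_cvg.
Qed.

Lemma one_sub_expS_neq0 (K : numFieldType) (p : K) (n : nat) :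
  `|p| < 1 -> 1 - p ^+ n.+1 != 0.
Proof. by move=> hp; rewrite exprS qfactor_neq0. Qed.

Lemma qpoch_inf_plus_sqr (K : numFieldType) (q : K) :
  geom_complete K -> `|q| < 1 ->
  qpoch_inf (q ^+ 2) (q ^+ 2) * qpoch_inf (- q ^+ 2) (q ^+ 2)
    = qpoch_inf (q ^+ 4) (q ^+ 4).
Proof.
move=> cK q1; have hq2 : `|q ^+ 2| < 1 by rewrite normrX exprn_ilt1.
by rewrite qpoch_inf_sqr// -!exprM.
Qed.

(** [(q;q)_oo] and [(q^2;q^2)_oo] are split by the parity of the index, and
    [(1 - x)(1 + x) = 1 - x^2] merges the odd factors. *)
Lemma qpoch_inf_plus_odd (K : numFieldType) (q : K) :
  geom_complete K -> `|q| < 1 ->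
  qpoch_inf (- q) (q ^+ 2) * (qpoch_inf q q * qpoch_inf (q ^+ 4) (q ^+ 4))
    = qpoch_inf (q ^+ 2) (q ^+ 2) ^+ 2.
Proof.
move=> cK q1; have hq2 : `|q ^+ 2| < 1 by rewrite normrX exprn_ilt1.
have h1 : qpoch_inf q q = qpoch_inf q (q ^+ 2) * qpoch_inf (q ^+ 2) (q ^+ 2).
  exact: qpoch_inf_double.
have h2 : qpoch_inf (q ^+ 2) (q ^+ 2) =
    qpoch_inf (q ^+ 2) (q ^+ 4) * qpoch_inf (q ^+ 4) (q ^+ 4).
  by rewrite (qpoch_inf_double _ cK hq2) -exprM -exprD.
have h3 : qpoch_inf q (q ^+ 2) * qpoch_inf (- q) (q ^+ 2) =
    qpoch_inf (q ^+ 2) (q ^+ 4).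
  by rewrite qpoch_inf_sqr// -exprM.
by rewrite h1 expr2 [X in _ = X * _]h2 -h3; ring.
Qed.

(** * Limits of q-series *)

(** Let [n] tend to infinity in [finite_jacobi]. With [P = (q^2;q^2)_oo] and [S] the sum of the
    series, the right side tends to [S / P^2] by [tannery] and the left side to [L / P], so
    [S = P L]. *)
Lemma jacobi_limit (K : numFieldType) (q y L C : K) :
  geom_complete K -> 0 < `|q| < 1 -> y != 0 ->
  (forall k, `|q ^+ (k * k.+1) * (y ^- k + y ^+ k.+1)| <= C * `|q| ^+ k) ->
  qpoch (- (q ^+ 2 / y)) (q ^+ 2) n * qpoch (- y) (q ^+ 2) n.+1 @[n --> \oo] --> L ->
  \sum_(k < n) q ^+ (k * k.+1) * (y ^- k + y ^+ k.+1) @[n --> \oo]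
    --> qpoch_inf (q ^+ 2) (q ^+ 2) * L.
Proof.
move=> cK /andP[q0 q1] y0 hw hL.
have hq : 0 <= `|q| < 1 by rewrite normr_ge0.
have hq2 : `|q ^+ 2| < 1 by rewrite normrX exprn_ilt1.
have [B B0 hB] := qpochV_bounded cK hq2 hq2.
have P0 := qpoch_inf_neq0 cK hq2 hq2.
have [S hS] := cvg_sum_geom cK hq hw.
set P := qpoch_inf _ _ in P0 *.
pose p := qpoch (q ^+ 2) (q ^+ 2).
have hp : p n @[n --> \oo] --> P by apply: qpoch_cvg.
have C0 : 0 <= C by have := hw 0%N; rewrite expr0 mulr1; apply: le_trans.
have B1 : forall n, `|(p n)^-1| <= B by [].
pose w k := q ^+ (k * k.+1) * (y ^- k + y ^+ k.+1).
have hwP : \sum_(k < n) w k / (P * P) @[n --> \oo] --> S / (P * P).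
  under eq_fun do rewrite -mulr_suml.
  by apply: cvgM => //; exact: cvg_cst.
have T : \sum_(k < n.+1) w k / (p (n - k)%N * p (n.+1 + k)%N)
    @[n --> \oo] --> S / (P * P).
  apply: (tannery (f := fun n k => w k / (p (n - k)%N * p (n.+1 + k)%N))
    (g := fun k => w k / (P * P)) (C := C * (B * B))
    (C' := C * `|(P * P)^-1|) cK hq _ _ _ hwP).
  - move=> n k kn; rewrite normrM mulrAC; apply: ler_pM => //; first exact: hw.
    by rewrite invfM normrM; apply: ler_pM.
  - by move=> k; rewrite normrM mulrAC; apply: ler_pM => //; exact: hw.
  - move=> k; apply: cvgM; first exact: cvg_cst.
    apply: cvgV; first by rewrite mulf_neq0.
    apply: cvgM; first by apply: (cvgn_comp (c := k)) hp => n; lia.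
    by apply: (cvgn_comp (c := 0)) hp => n; lia.
have hq0 : q != 0 by rewrite -normr_gt0.
have T2 : \sum_(k < n.+1) w k / (p (n - k)%N * p (n.+1 + k)%N)
    @[n --> \oo] --> L / P.
  rewrite (_ : (fun n => _) = (fun n => qpoch (- (q ^+ 2 / y)) (q ^+ 2) n
      * qpoch (- y) (q ^+ 2) n.+1 / p n.*2.+1)); last first.
    by apply/funext => n; rewrite finite_jacobi// => m; apply: one_sub_expS_neq0.
  apply: cvgM => //; apply: cvgV => //.
  by apply: (cvgn_comp (c := 0)) hp => n; lia.
have /(congr1 (fun x => x * (P * P))) := cvgn_unique T T2.
rewrite divfK ?mulf_neq0// mulrA divfK// mulrC => <-.
exact: hS.
Qed.

(** The case [y = 1]: every term is doubled, and so is the product, through the first factor [1 + 1]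
    of [(-1;q^2)_(n+1)]. *)
Lemma sum_theta1_cvg (K : numFieldType) (q : K) :
  geom_complete K -> 0 < `|q| < 1 ->
  \sum_(k < n) q ^+ (k * k.+1) @[n --> \oo]
    --> qpoch_inf (q ^+ 2) (q ^+ 2) * qpoch_inf (- q ^+ 2) (q ^+ 2) ^+ 2.
Proof.
move=> cK /[dup] hq /andP[q0 q1].
have hq2 : `|q ^+ 2| < 1 by rewrite normrX exprn_ilt1.
pose L := qpoch_inf (- q ^+ 2) (q ^+ 2) ^+ 2 * 2.
have hk k : q ^+ (k * k.+1) * (1 ^- k + 1 ^+ k.+1) = q ^+ (k * k.+1) * 2.
  by rewrite !expr1n invr1.
have h : \sum_(k < n) q ^+ (k * k.+1) * (1 ^- k + 1 ^+ k.+1) @[n --> \oo]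
    --> qpoch_inf (q ^+ 2) (q ^+ 2) * L.
  apply: (jacobi_limit (C := 2)) => // [k|].
    rewrite hk normrM mulrC (ger0_norm (ler0n K 2)) ler_wpM2l// normrX.
    by apply: ler_wiXn2l => //; [exact: ltW|nia].
  rewrite divr1 (_ : (fun n => _) = (fun n => qpoch (- q ^+ 2) (q ^+ 2) n
      * qpoch (- q ^+ 2) (q ^+ 2) n * 2)).
    rewrite /L expr2; apply: cvgM; last exact: cvg_cst.
    by apply: cvgM; apply: qpoch_cvg.
  by apply/funext => n; rewrite qpochSl mulN1r; ring.
rewrite (_ : (fun n => _) = (fun n => (\sum_(k < n)
    q ^+ (k * k.+1) * (1 ^- k + 1 ^+ k.+1)) * 2^-1)); last first.
  apply/funext => n; rewrite mulr_suml; apply: eq_bigr => k _.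
  by rewrite hk mulfK ?pnatr_eq0.
rewrite (_ : _ * _ ^+ 2 = qpoch_inf (q ^+ 2) (q ^+ 2) * L * 2^-1).
  by apply: cvgM => //; exact: cvg_cst.
by rewrite /L !mulrA mulfK ?pnatr_eq0.
Qed.

(** The case [y = q]: the exponents become [k(k+1) - k = k^2] and [k(k+1) + k + 1 = (k+1)^2]. *)
Lemma sum_theta2_cvg (K : numFieldType) (q : K) :
  geom_complete K -> 0 < `|q| < 1 ->
  \sum_(k < n) (q ^+ (k ^ 2) + q ^+ (k.+1 ^ 2)) @[n --> \oo]
    --> qpoch_inf (q ^+ 2) (q ^+ 2) * qpoch_inf (- q) (q ^+ 2) ^+ 2.
Proof.
move=> cK /[dup] hq /andP[q0 q1].
have q_neq0 : q != 0 by rewrite -normr_gt0.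
have hq2 : `|q ^+ 2| < 1 by rewrite normrX exprn_ilt1.
have hk k : q ^+ (k * k.+1) * (q ^- k + q ^+ k.+1) = q ^+ (k ^ 2) + q ^+ (k.+1 ^ 2).
  rewrite mulrDr -exprD; congr (_ + q ^+ _); last by lia.
  have -> : (k * k.+1 = k ^ 2 + k)%N by lia.
  by rewrite exprD mulfK// expf_neq0.
rewrite (_ : (fun n => _) = (fun n => \sum_(k < n)
    q ^+ (k * k.+1) * (q ^- k + q ^+ k.+1))); last first.
  by apply/funext => n; apply: eq_bigr => k _; rewrite hk.
apply: (jacobi_limit (C := 2)) => // [k|].
  rewrite hk; apply: (le_trans (ler_normD _ _)); rewrite !normrX mulr2n mulrDl mul1r.
  by apply: lerD; apply: ler_wiXn2l => //; [exact: ltW|nia|exact: ltW|nia].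
have -> : - (q ^+ 2 / q) = - q by rewrite expr2 mulfK.
rewrite expr2; apply: cvgM; first exact: qpoch_cvg.
by apply: (cvgn_comp (c := 0)) (qpoch_cvg cK hq2) => n; lia.
Qed.

(* Both sides of [qpoch_conv] tend to their limits, and the alternating series on
   its left is evaluated by letting [m] tend to infinity in [q_binomial] at
   [x = - q ^ 2]. *)
Lemma euler_sum_cvg (K : numFieldType) (q : K) :
  geom_complete K -> `|q| < 1 ->
  \sum_(l < n) q ^+ l / qpoch (q ^+ 2) (q ^+ 2) l @[n --> \oo]
    --> qpoch_inf (q ^+ 2) (q ^+ 2) / qpoch_inf q q.
Proof.
move=> cK q1.
have hq : 0 <= `|q| < 1 by rewrite normr_ge0.
have hq2 : `|q ^+ 2| < 1 by rewrite normrX exprn_ilt1.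
have [B B0 hB] := qpochV_bounded cK hq2 hq2.
have [B' B'0 hB'] := qpochV_bounded cK q1 q1.
have P0 := qpoch_inf_neq0 cK hq2 hq2.
have Q0 := qpoch_inf_neq0 cK q1 q1.
have hP := qpoch_cvg (a := q ^+ 2) cK hq2.
have hQ := qpoch_cvg (a := q) cK q1.
set P := qpoch_inf _ _ in P0 hP *; set Q := qpoch_inf _ _ in Q0 hQ *.
pose d j := (-1) ^+ j * q ^+ (j * j.+1) / qpoch (q ^+ 2) (q ^+ 2) j.
have hd j : `|d j| <= B * `|q| ^+ j.
  rewrite /d normrM mulrC; apply: ler_pM => //.
  rewrite normrM normrX normrN1 expr1n mul1r normrX.
  by apply: ler_wiXn2l => //; [exact: ltW|nia].
have [S hS] := cvg_sum_geom cK hq hd.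
(* Used twice: with [(q^2;q^2)_n] to determine [S], then with [(q;q)_n] to obtain the required
   limit. *)
have key (u : nat -> K) (U D : K) : U != 0 -> (forall n, `|(u n)^-1| <= D) -> 0 <= D ->
    u n @[n --> \oo] --> U ->
    \sum_(j < n.+1) d j / u (n - j)%N @[n --> \oo] --> S / U.
  move=> U0 hu D0 uU.
  have hSU : \sum_(k < n) d k / U @[n --> \oo] --> S / U.
    under eq_fun do rewrite -mulr_suml.
    by apply: cvgM => //; exact: cvg_cst.
  have uV : (u n)^-1 @[n --> \oo] --> U^-1 by apply: cvgV.
  apply: (tannery (f := fun n k => d k / u (n - k)%N) (g := fun k => d k / U)
    (C := B * D) (C' := B * `|U^-1|) cK hq _ _ _ hSU).
  - by move=> n k kn; rewrite normrM mulrAC; apply: ler_pM.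
  - by move=> k; rewrite normrM mulrAC; apply: ler_pM.
  - move=> k; apply: cvgM; first exact: cvg_cst.
    by apply: (cvgn_comp (c := k)) uV => n; lia.
have SP : S = P.
  have h := key _ _ _ P0 hB B0 hP.
  have h1 : \sum_(j < n.+1) d j / qpoch (q ^+ 2) (q ^+ 2) (n - j)%N
      @[n --> \oo] --> (1 : K).
    rewrite (_ : (fun n => _) = fun=> 1); first exact: cvg_cst.
    apply/funext => n.
    (* At [x = - q^2] the numerator and denominator coincide, so every one of these sums equals
       1. *)
    transitivity (qpoch (- - q ^+ 2) (q ^+ 2) n / qpoch (q ^+ 2) (q ^+ 2) n).
      rewrite q_binomial; last by move=> m; apply: one_sub_expS_neq0.
      apply: eq_bigr => j _; rewrite invfM mulrA; congr (_ / _ / _).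
      rewrite (exprNn (q ^+ 2)) -exprM mulrCA -exprD; congr (_ * _ ^+ _).
      by case: (nat_of_ord j) => //= m; lia.
    by rewrite opprK divff// qpoch_neq0.
  by have := cvgn_unique h h1 => /(congr1 ( *%R^~ P)); rewrite mul1r divfK.
have h := key _ _ _ Q0 hB' B'0 hQ.
rewrite -(cvg_shiftS (fun n => \sum_(l < n) q ^+ l / qpoch (q ^+ 2) (q ^+ 2) l)) -SP.
under eq_fun => n.
  rewrite -qpoch_conv; last by move=> m; apply: one_sub_expS_neq0.
  over.
rewrite (_ : (fun n => _) = (fun n => \sum_(j < n.+1) d j / qpoch q q (n - j)%N))//.
apply/funext => n; apply: eq_bigr => j _.
by rewrite /d invfM [LHS]mulrA [LHS]mulrAC.
Qed.

(** * Triple sums *)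

Definition box (M : nat) : seq (nat * nat * nat) :=
  [seq (p, k) | p <- [seq (i, j) | i <- index_iota 0 M, j <- index_iota 0 M],
                k <- index_iota 0 M].

Lemma mem_box (M : nat) (t : nat * nat * nat) :
  (t \in box M) = [&& (t.1.1 < M)%N, (t.1.2 < M)%N & (t.2 < M)%N].
Proof.
case: t => [[i j] k]; apply/allpairsP/and3P => /=.
  move=> [[p k'] [/= /allpairsP[[i' j'] [/= hi hj ->]] hk [-> -> ->]]].
  by move: hi hj hk; rewrite !mem_index_iota.
move=> [hi hj hk]; exists ((i, j), k); split; rewrite ?mem_index_iota//=.
by apply: allpairs_f; rewrite mem_index_iota.
Qed.

Lemma box_uniq (M : nat) : uniq (box M).
Proof.
apply: allpairs_uniq; rewrite ?iota_uniq//; last by move=> [? ?] [? ?] _ _ [-> ->].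
by apply: allpairs_uniq; rewrite ?iota_uniq//; move=> [? ?] [? ?] _ _ [-> ->].
Qed.

Lemma sum_box (V : zmodType) (F : nat * nat * nat -> V)
    (P : pred (nat * nat * nat)) (M : nat) :
  \sum_(t <- box M | P t) F t =
  \sum_(i < M) \sum_(j < M)
    \sum_(k < M | P (val i, val j, val k)) F (val i, val j, val k).
Proof.
rewrite big_mkcond /box big_allpairs big_allpairs.
rewrite big_mkord; apply: eq_bigr => i _.
rewrite big_mkord; apply: eq_bigr => j _.
by rewrite big_mkord [RHS]big_mkcond.
Qed.

(** [A] fits in a box, over which the sum factors as the cube of a geometric sum. *)
Lemma sum_geom3_le (K : numFieldType) (s : K) (A : seq (nat * nat * nat)) :
  0 <= s < 1 -> uniq A ->
  \sum_(t <- A) s ^+ (t.1.1 + t.1.2 + t.2) <= (1 - s)^-1 ^+ 3.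
Proof.
move=> hs uA; have /andP[s0 s1] := hs.
have s1' : 0 <= 1 - s by rewrite subr_ge0 ltW.
pose M := (\max_(t <- A) (t.1.1 + t.1.2 + t.2)%N).+1.
have hM t : t \in A -> (t.1.1 + t.1.2 + t.2 < M)%N.
  by move=> tA; rewrite /M ltnS (big_rem t)//= leq_maxl.
have hp : perm_eq A [seq t <- box M | t \in A].
  apply: uniq_perm => //; first by rewrite filter_uniq// box_uniq.
  move=> t; rewrite mem_filter mem_box; case tA : (t \in A) => //=.
  by have := hM _ tA; move: t {tA} => [[i j] k] /=; lia.
rewrite (perm_big _ hp) big_filter.
apply: (@le_trans _ _ (\sum_(t <- box M) s ^+ (t.1.1 + t.1.2 + t.2))).
  rewrite big_mkcond; apply: ler_sum => t _; case: ifP => // _.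
  by rewrite exprn_ge0.
rewrite sum_box /=.
under eq_bigr do under eq_bigr do under eq_bigr do rewrite exprD.
under eq_bigr do under eq_bigr do rewrite -mulr_sumr exprD.
under eq_bigr do rewrite -mulr_suml -mulr_sumr.
rewrite -!mulr_suml -expr2 -exprSr.
by rewrite lerXn2r ?nnegrE ?sumr_ge0 ?invr_ge0//;
  [move=> *; rewrite exprn_ge0|exact: geom_sum_le].
Qed.

Lemma sum_triangle (V : zmodType) (G : nat -> nat -> V) (M : nat) :
  \sum_(i < M) \sum_(j < M | (i + j < M)%N) G i j =
  \sum_(m < M) \sum_(j < m.+1) G (m - j)%N j.
Proof.
transitivity (\sum_(m < M) \sum_(j < M | (j <= m)%N) G (m - j)%N j); last first.
  apply: eq_bigr => m _.
  rewrite -(big_mkord (fun j => j <= m)%N (fun j => G (m - j)%N j)).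
  rewrite -(big_mkord xpredT (fun j => G (m - j)%N j)).
  rewrite (big_nat_widen _ _ _ _ _ (ltn_ord m)).
  by apply: eq_bigl => j; rewrite ltnS.
rewrite (exchange_big_dep xpredT)//= [RHS](exchange_big_dep xpredT)//=.
apply: eq_bigr => j _.
rewrite -(big_mkord (fun i => i + j < M)%N (fun i => G i j)).
rewrite -(big_mkord (fun m => j <= m)%N (fun m => G (m - j)%N j)).
rewrite -(big_nat_widenl j 0 M xpredT)// -{3}[nat_of_ord j]add0n big_addn.
rewrite [RHS](big_nat_widen _ _ M)//; last exact: leq_subr.
by apply: eq_big => [i|i _]; rewrite ?addnK//= ltn_subRL addnC.
Qed.

(** Reduces unconditional summation to one exhausting sequence, whose shape [i + j < M], [k < M]
    suits summation along [i + j = m]. A triple outside it has [i + j + k >= M]; of the two powers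
    of [s] in the bound, one then gives [s^M] and the other remains summable. *)
Lemma has_sum3_exhaust (K : numFieldType) (f : nat -> nat -> nat -> K) (C s l : K) :
  geom_complete K -> 0 <= s < 1 ->
  (forall i j k, `|f i j k| <= C * (s ^+ 2) ^+ (i + j + k)) ->
  \sum_(i < M) \sum_(j < M) \sum_(k < M | (i + j < M)%N) f i j k @[M --> \oo] --> l ->
  has_sum3 f l.
Proof.
move=> cK hs hf hl; have /andP[s0 s1] := hs.
have C0 : 0 <= C by have := hf 0%N 0%N 0%N; rewrite expr0 mulr1; apply: le_trans.
pose F (t : nat * nat * nat) := f t.1.1 t.1.2 t.2.
pose D := C * (1 - s)^-1 ^+ 3.
have D0 : 0 <= D by rewrite mulr_ge0// exprn_ge0// invr_ge0 subr_ge0 ltW.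
have tF := @totally_filter (nat * nat * nat)%type.
rewrite /has_sum3; apply/cvgrPdist_le => e e0.
have e2 : 0 < e / 2 by rewrite divr_gt0.
have /cvgrPdist_le /(_ _ e2) hM := hl.
(* One [M] serves both halves of [e]: the truncated sum is near [l], and all terms outside add up to
   at most [D * s^M]. *)
have [M _ /(_ M (leqnn M)) [hM1 hM2]] := filterI hM (geom_small cK hs D0 e2).
pose P (t : nat * nat * nat) := (t.1.1 + t.1.2 < M)%N.
pose B := [fset t in [seq t <- box M | P t]]%fset.
exists B => // A /= BA.
rewrite /partial_sum -(big_seq_fsetE _ _ predT F)/=.
have -> : \sum_(t <- A) F t = \sum_(t <- B) F t + \sum_(t <- (A `\` B)%fset) F t.
  rewrite -big_cat; apply: perm_big; apply: uniq_perm => [||t]; first exact: fset_uniq.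
    rewrite cat_uniq !fset_uniq andbT /=; apply/hasPn => t.
    by rewrite in_fsetD => /andP[].
  rewrite mem_cat in_fsetD; case tB : (t \in B) => //=.
  exact: (fsubsetP BA).
have -> : \sum_(t <- B) F t =
    \sum_(i < M) \sum_(j < M) \sum_(k < M | (i + j < M)%N) f i j k.
  rewrite -(sum_box F P) -[RHS]big_filter; apply: perm_big.
  apply: uniq_perm => [||t]; first exact: fset_uniq.
    by rewrite filter_uniq// box_uniq.
  by rewrite !inE.
rewrite opprD addrA; apply: (le_trans (ler_normB _ _)).
rewrite [leRHS](_ : e = e / 2 + e / 2); last by field.
apply: lerD => //.
apply: le_trans hM2; rewrite /D.
apply: (le_trans (ler_norm_sum _ _ _)).
rewrite mulrAC -mulrA.
apply: (@le_trans _ _ (\sum_(t <- (A `\` B)%fset)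
    (C * s ^+ M) * s ^+ (t.1.1 + t.1.2 + t.2))).
  rewrite big_seq [leRHS]big_seq; apply: ler_sum => t.
  rewrite in_fsetD => /andP[tB _].
  apply: (le_trans (hf _ _ _)); rewrite -mulrA ler_wpM2l//.
  rewrite -exprM mul2n -addnn exprD ler_wpM2r ?exprn_ge0//.
  apply: ler_wiXn2l => //; first exact: ltW.
  rewrite leqNgt; apply: contra tB => h.
  rewrite !inE/= mem_filter mem_box /P; move: h.
  by move: t => [[i j] k] /=; lia.
rewrite -mulr_sumr mulrA ler_wpM2l//; first by rewrite mulr_ge0 ?exprn_ge0.
by apply: sum_geom3_le => //; exact: fset_uniq.
Qed.

(* The primitive vanishing at 0, made odd by construction; it is a primitive of [w]
   only when [w (-1-x) = w x]. *)
Definition prim (V : zmodType) (w : int -> V) (x : int) : V :=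
  match x with
  | Posz n => \sum_(k < n) w k%:Z
  | Negz n => - \sum_(k < n.+1) w k%:Z
  end.

(** As [Negz n] is [-1-n], the hypothesis is the symmetry [w (-1-x) = w x]; it gives the right
    increments at negative arguments. *)
Lemma primS (V : zmodType) (w : int -> V) (x : int) :
  (forall n, w (Negz n) = w n%:Z) -> prim w (x + 1) - prim w x = w x.
Proof.
move=> hw; case: x => [n|[|n]].
- have -> : n%:Z + 1 = n.+1%:Z by lia.
  by rewrite /= big_ord_recr/= addrAC subrr add0r.
- by rewrite hw /= big_ord0 big_ord1 opprK add0r.
- have -> : Negz n.+1 + 1 = Negz n by lia.
  by rewrite hw /= opprK [X in _ + X]big_ord_recr/= addKr.
Qed.

Lemma primN (V : zmodType) (w : int -> V) (x : int) : prim w (- x) = - prim w x.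
Proof.
case: x => [[|n]|n]; first by rewrite oppr0 /= big_ord0 oppr0.
  by have -> : - n.+1%:Z = Negz n by lia.
have -> : - Negz n = n.+1%:Z by lia.
by rewrite /= opprK.
Qed.

Lemma sum_prim (V : zmodType) (w : int -> V) (n : nat) (d : int) :
  (forall n, w (Negz n) = w n%:Z) ->
  \sum_(i < n) w (i%:Z + d) = prim w (n%:Z + d) - prim w d.
Proof.
move=> hw; elim: n => [|n IH]; first by rewrite big_ord0 add0r subrr.
rewrite big_ord_recr/= IH -(primS _ hw) addrC addrA subrK.
by congr (prim w _ - _); lia.
Qed.

(* The terms [prim w (l - k)] are antisymmetric in [l] and [k] and cancel. *)
Lemma prefix_sum_conv (K : numFieldType) (a : nat -> K) (w : int -> K) (M : nat) :
  (forall n, w (Negz n) = w n%:Z) ->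
  \sum_(m < M) (\sum_(l < m.+1) a l) * \sum_(k < M) a k * w (m%:Z - k%:Z) =
  (\sum_(l < M) a l) * \sum_(k < M) a k * \sum_(i < (M - k)%N) w i%:Z.
Proof.
move=> hw.
transitivity (\sum_(l < M) \sum_(k < M) a l * a k *
    (\sum_(i < (M - k)%N) w i%:Z - prim w (l%:Z - k%:Z))).
  transitivity (\sum_(m < M) \sum_(l < M | (l <= m)%N) \sum_(k < M)
      a l * a k * w (m%:Z - k%:Z)).
    apply: eq_bigr => m _.
    rewrite (big_ord_widen M a (ltn_ord m)) mulr_suml.
    apply: eq_big => [l|l _]; first by rewrite ltnS.
    by rewrite mulr_sumr; apply: eq_bigr => k _; rewrite mulrA.
  rewrite (exchange_big_dep xpredT)//=; apply: eq_bigr => l _.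
  rewrite exchange_big/=; apply: eq_bigr => k _.
  rewrite -mulr_sumr; congr (_ * _).
  rewrite -(big_mkord (fun m => l <= m)%N (fun m => w (m%:Z - k%:Z))).
  rewrite -(big_nat_widenl l 0 M xpredT)// -{1}[nat_of_ord l]add0n big_addn big_mkord.
  transitivity (\sum_(i < (M - l)%N) w (i%:Z + (l%:Z - k%:Z))).
    by apply: eq_bigr => i _; rewrite PoszD addrA.
  rewrite sum_prim//; congr (_ - _).
  (* The upper endpoint is free of [l] and nonnegative, so there [prim w] is by definition a partial
     sum of [w]. *)
  have -> : (M - l)%N%:Z + (l%:Z - k%:Z) = (M - k)%N%:Z.
    by have := ltn_ord l; have := ltn_ord k; lia.
  by [].
under eq_bigr do under eq_bigr do rewrite mulrBr.
under eq_bigr do rewrite sumrB.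
rewrite sumrB -[RHS]subr0; congr (_ - _).
  rewrite mulr_suml; apply: eq_bigr => l _.
  by rewrite mulr_sumr; apply: eq_bigr => k _; rewrite mulrA.
set T := LHS.
have : T = - T.
  rewrite {1}/T exchange_big/= /T -sumrN; apply: eq_bigr => l _.
  rewrite -sumrN; apply: eq_bigr => k _.
  by rewrite -[in LHS]opprB primN mulrN [a k * _]mulrC.
by move=> /eqP; rewrite -addr_eq0 -mulr2n mulrn_eq0 => /eqP.
Qed.

(** The common form of both identities. The coefficients are only bounded in [i], so decay in [i]
    must come from [w]; this costs a square root of [|q|], and the tail estimate of
    [has_sum3_exhaust] costs another, hence [|q| = s^4]. *)
Lemma has_sum3_conv (K : numFieldType) (q s W C : K) (w : int -> K) :
  geom_complete K -> 0 <= s < 1 -> `|q| = s ^+ 4 ->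
  (forall n, w (Negz n) = w n%:Z) ->
  (forall n : nat, `|w n%:Z| <= C * `|q| ^+ n) ->
  \sum_(k < n) w k%:Z @[n --> \oo] --> W ->
  has_sum3 (fun i j k =>
      (-1) ^+ j * q ^+ (j * j.+1) / (qpoch q q i * qpoch (q ^+ 2) (q ^+ 2) j)
      * (q ^+ k / qpoch (q ^+ 2) (q ^+ 2) k) * w (i%:Z + j%:Z - k%:Z))
    (W * (qpoch_inf (q ^+ 2) (q ^+ 2) / qpoch_inf q q) ^+ 2).
Proof.
move=> cK hs qs hwN hw hW; have /andP[s0 s1] := hs.
have q1 : `|q| < 1 by rewrite qs exprn_ilt1.
have hq : 0 <= `|q| < 1 by rewrite normr_ge0.
have hq2 : `|q ^+ 2| < 1 by rewrite normrX exprn_ilt1.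
have [B B0 hB] := qpochV_bounded cK hq2 hq2.
have [B' B'0 hB'] := qpochV_bounded cK q1 q1.
have C0 : 0 <= C by have := hw 0%N; rewrite expr0 mulr1; apply: le_trans.
pose e i j := (-1) ^+ j * q ^+ (j * j.+1) / (qpoch q q i * qpoch (q ^+ 2) (q ^+ 2) j).
pose a k := q ^+ k / qpoch (q ^+ 2) (q ^+ 2) k.
have ha k : `|a k| <= B * `|q| ^+ k.
  by rewrite normrM mulrC normrX ler_wpM2r ?exprn_ge0.
have he i j : `|e i j| <= B' * B * `|q| ^+ j.
  rewrite normrM mulrC invfM; apply: ler_pM => //.
    by rewrite normrM; apply: ler_pM.
  rewrite normrM normrX normrN1 expr1n mul1r normrX.
  by apply: ler_wiXn2l => //; [exact: ltW|nia].
apply: (@has_sum3_exhaust _ _ (B' * B * B * C) s) => //.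
  move=> i j k; rewrite -/(e i j) -/(a k) (normrM (e i j * a k)) (normrM (e i j)).
  (* [N] is whichever of [x] and [-1-x] is nonnegative, for [x = i + j - k]. Then
     [i + j + k <= 2 (j + k + N)], which converts the bound in [|q|] into one in [s^2]. *)
  have [N -> hN] : exists2 N : nat,
      `|w (i%:Z + j%:Z - k%:Z)| = `|w N%:Z| & (i <= N + k)%N.
    case E : (i%:Z + j%:Z - k%:Z) => [N|N]; first by exists N => //; lia.
    by exists N; [rewrite hwN|lia].
  apply: (@le_trans _ _ (B' * B * `|q| ^+ j * (B * `|q| ^+ k) * (C * `|q| ^+ N))).
    by apply: ler_pM => //; apply: ler_pM.
  rewrite (_ : _ * _ * _ = B' * B * B * C * `|q| ^+ (j + k + N)); last first.
    by rewrite !exprD; ring.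
  rewrite ler_wpM2l ?mulr_ge0// qs -!exprM.
  by apply: ler_wiXn2l => //; [exact: ltW|lia].
pose X M := (\sum_(l < M) a l) * \sum_(k < M) a k * \sum_(i < (M - k)%N) w i%:Z.
rewrite (_ : (fun M => _) = X); last first.
  apply/funext => M; rewrite /X -prefix_sum_conv//.
  under eq_bigr do under eq_bigr do rewrite big_mkcond/=.
  transitivity (\sum_(i < M) \sum_(j < M | (i + j < M)%N)
      \sum_(k < M) e i j * a k * w (i%:Z + j%:Z - k%:Z)).
    apply: eq_bigr => i _; rewrite [RHS]big_mkcond; apply: eq_bigr => j _.
    by case: ifP => // _; rewrite big1.
  rewrite (sum_triangle (fun i j => \sum_(k < M) e i j * a k * w (i%:Z + j%:Z - k%:Z))).
  apply: eq_bigr => m _.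
  rewrite -qpoch_conv; last by move=> n; apply: one_sub_expS_neq0.
  rewrite mulr_suml; apply: eq_bigr => j _.
  rewrite mulr_sumr; apply: eq_bigr => k _.
  rewrite -/(e _ _) mulrA; congr (_ * w (_ - _)).
  by have := ltn_ord j; lia.
(* The shift to [M = n + 1] matches the range [k < n.+1] in [tannery]. *)
rewrite -(cvg_shiftS X).
have hA := euler_sum_cvg cK q1.
rewrite expr2 mulrA [W * _]mulrC -mulrA [W * _]mulrC.
apply: cvgM; first by rewrite (cvg_shiftS (fun n => \sum_(l < n) a l)).
have r1' : 0 < 1 - `|q| by rewrite subr_gt0.
apply: (tannery (f := fun n k => a k * \sum_(i < (n.+1 - k)%N) w i%:Z)
  (g := fun k => a k * W) (C := B * (C / (1 - `|q|))) (C' := B * `|W|) cK hq).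
- move=> n k _; rewrite normrM mulrAC; apply: ler_pM => //.
  apply: (le_trans (ler_norm_sum _ _ _)).
  apply: (@le_trans _ _ (\sum_(i < (n.+1 - k)%N) C * `|q| ^+ i)); first exact: ler_sum.
  by rewrite -mulr_sumr ler_wpM2l// geom_sum_le.
- by move=> k; rewrite normrM mulrAC ler_wpM2r.
- move=> k; apply: cvgM; first exact: cvg_cst.
  by apply: (cvgn_comp (c := k)) hW => n; lia.
- by under eq_fun do rewrite -mulr_suml; apply: cvgM => //; exact: cvg_cst.
Qed.

(** * The two identities over a geometrically complete field *)

Lemma has_sum3_theta1 (K : numFieldType) (q s : K) :
  geom_complete K -> 0 < `|q| < 1 -> 0 <= s < 1 -> `|q| = s ^+ 4 ->
  has_sum3
    (fun i j k : nat =>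
       (-1) ^+ j
       * q ^ (i%:Z + j%:Z ^+ 2 + 2 * j%:Z + (i%:Z + j%:Z - k%:Z) ^+ 2)
       / (qpoch q q i * qpoch (q ^+ 2) (q ^+ 2) j * qpoch (q ^+ 2) (q ^+ 2) k))
    (qpoch_inf (q ^+ 2) (q ^+ 2) * qpoch_inf (q ^+ 4) (q ^+ 4) ^+ 2
     / qpoch_inf q q ^+ 2).
Proof.
have natE (n : nat) : n%:Z ^+ 2 + n%:Z = (n * n.+1)%N%:Z by lia.
have NegzE2 n : Negz n ^+ 2 + Negz n = n%:Z ^+ 2 + n%:Z by lia.
have expE (i j k : nat) (n : int) : n = i%:Z + j%:Z - k%:Z ->
    i%:Z + j%:Z ^+ 2 + 2 * j%:Z + n ^+ 2 = (j * j.+1)%N%:Z + k%:Z + (n ^+ 2 + n).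
  by move=> ->; lia.
have le_pronic k : (k <= k * k.+1)%N by nia.
move=> cK hq hs qs; have /andP[q0 q1] := hq.
have q_neq0 : q != 0 by rewrite -normr_gt0.
pose w (x : int) := q ^ (x ^+ 2 + x).
have wE (n : nat) : w n%:Z = q ^+ (n * n.+1) by rewrite /w natE (exprnP q).
have wN n : w (Negz n) = w n%:Z by rewrite /w NegzE2.
have wB (n : nat) : `|w n%:Z| <= 1 * `|q| ^+ n.
  by rewrite wE mul1r normrX ler_wiXn2l// ltW.
have hW : \sum_(k < n) w k%:Z @[n --> \oo] -->
    qpoch_inf (q ^+ 2) (q ^+ 2) * qpoch_inf (- q ^+ 2) (q ^+ 2) ^+ 2.
  rewrite (_ : (fun n => _) = (fun n => \sum_(k < n) q ^+ (k * k.+1))).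
    exact: sum_theta1_cvg.
  by apply/funext => n; apply: eq_bigr => k _; rewrite wE.
have := has_sum3_conv cK hs qs wN wB hW.
congr has_sum3.
  apply/funext => i; apply/funext => j; apply/funext => k; rewrite /w.
  rewrite (expE i j k _ erefl) !expfzDr// -!(exprnP q) !invfM.
  by ring.
rewrite -(qpoch_inf_plus_sqr cK q1) expr_div_n exprMn.
move: (qpoch_inf _ _) (qpoch_inf _ _) ((_ ^+ 2)^-1) => a b c.
by ring.
Qed.

Lemma has_sum3_theta2 (K : numFieldType) (q s : K) :
  geom_complete K -> 0 < `|q| < 1 -> 0 <= s < 1 -> `|q| = s ^+ 4 ->
  has_sum3
    (fun i j k : nat =>
       (-1) ^+ j
       * q ^ (j%:Z ^+ 2 + j%:Z + k%:Z)
       * (q ^ ((i%:Z + j%:Z - k%:Z) ^+ 2) + q ^ ((i%:Z + j%:Z - k%:Z + 1) ^+ 2))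
       / (qpoch q q i * qpoch (q ^+ 2) (q ^+ 2) j * qpoch (q ^+ 2) (q ^+ 2) k))
    (qpoch_inf (q ^+ 2) (q ^+ 2) ^+ 7
     / (qpoch_inf q q ^+ 4 * qpoch_inf (q ^+ 4) (q ^+ 4) ^+ 2)).
Proof.
have natE (n : nat) : n%:Z ^+ 2 = (n ^ 2)%N%:Z by lia.
have pronicE (n : nat) : n%:Z ^+ 2 + n%:Z = (n * n.+1)%N%:Z by lia.
have natS (n : nat) : n%:Z + 1 = n.+1%:Z by lia.
have NegzE2 n : Negz n ^+ 2 = n.+1%:Z ^+ 2 by lia.
have NegzSE2 n : (Negz n + 1) ^+ 2 = n%:Z ^+ 2 by lia.
have le_sqr k : (k <= k ^ 2)%N by nia.
have le_sqrS k : (k <= k.+1 ^ 2)%N by nia.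
move=> cK hq hs qs; have /andP[q0 q1] := hq.
have hq2 : `|q ^+ 2| < 1 by rewrite normrX exprn_ilt1.
have hq4 : `|q ^+ 4| < 1 by rewrite normrX exprn_ilt1.
have q_neq0 : q != 0 by rewrite -normr_gt0.
pose w (x : int) := q ^ (x ^+ 2) + q ^ ((x + 1) ^+ 2).
have wE (n : nat) : w n%:Z = q ^+ (n ^ 2) + q ^+ (n.+1 ^ 2).
  by rewrite /w natS !natE !(exprnP q).
have wN n : w (Negz n) = w n%:Z by rewrite /w NegzE2 NegzSE2 natS addrC.
have wB (n : nat) : `|w n%:Z| <= 2 * `|q| ^+ n.
  rewrite wE; apply: (le_trans (ler_normD _ _)).
  by rewrite !normrX mulr2n mulrDl mul1r lerD// ler_wiXn2l// ltW.
have hW : \sum_(k < n) w k%:Z @[n --> \oo] -->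
    qpoch_inf (q ^+ 2) (q ^+ 2) * qpoch_inf (- q) (q ^+ 2) ^+ 2.
  rewrite (_ : (fun n => _) =
      (fun n => \sum_(k < n) (q ^+ (k ^ 2) + q ^+ (k.+1 ^ 2)))).
    exact: sum_theta2_cvg.
  by apply/funext => n; apply: eq_bigr => k _; rewrite wE.
have := has_sum3_conv cK hs qs wN wB hW.
congr has_sum3.
  apply/funext => i; apply/funext => j; apply/funext => k; rewrite /w.
  rewrite pronicE (expfzDr (j * j.+1)%N%:Z k%:Z)// -!(exprnP q) !invfM.
  by ring.
have := qpoch_inf_plus_odd cK q1.
have := qpoch_inf_neq0 cK hq4 hq4; have := qpoch_inf_neq0 cK q1 q1.
move: (qpoch_inf (- q) _) (qpoch_inf q q) (qpoch_inf (q ^+ 4) _)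
  (qpoch_inf (q ^+ 2) _) => o a f p a0 f0 hO.
(* The value is [p o^2 (p/a)^2], which this substitution turns into [p^7 / (a^4 f^2)]. *)
have -> : o = p ^+ 2 / (a * f) by rewrite -hO mulfK// mulf_neq0.
by field; rewrite a0 f0.
Qed.

(** * The complex numbers *)

Lemma normc_i (R : rcfType) : `|'i%C : R[i]| = 1.
Proof. by rewrite normc_def /= expr0n expr1n add0r sqrtr1. Qed.

Lemma norm_le_Re_Im (R : rcfType) (z : R[i]) :
  `|z| <= (`|complex.Re z| + `|complex.Im z|)%:C.
Proof.
rewrite {1}[z]complexE; apply: (le_trans (ler_normD _ _)).
rewrite normrM normc_i mul1r !normc_def /= !expr0n !addr0 !sqrtr_sqr.
by rewrite -rmorphD.
Qed.

Lemma normc_ge_Im (R : rcfType) (z : R[i]) : `|complex.Im z|%:C <= `|z|.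
Proof.
have := normc_ge_Re (z * 'i%C).
by rewrite ReiNIm normrN normrM normc_i mulr1.
Qed.

(** The telescoping series of [v] converges absolutely by comparison with a geometric series. *)
Lemma cvg_of_geom_increments (R : realType) (v : nat -> R) (c r : R) :
  0 <= r < 1 -> (forall n, `|v n.+1 - v n| <= c * r ^+ n) ->
  cvg (v n @[n --> \oo]).
Proof.
move=> /andP[r0 r1] hv.
have h : cvgn (series (telescope v)).
  apply: normed_cvg; apply: (@series_le_cvg _ _ (geometric c r)) => [n|n|n|] /=.
  - exact: normr_ge0.
  - exact: le_trans (hv n).
  - exact: hv.
  - by apply: is_cvg_geometric_series; rewrite ger0_norm.
rewrite -[X in cvg (X @ _)](_ : (fun n => series (telescope v) n + v 0%N) = v).
  by apply: is_cvgD => //; exact: is_cvg_cst.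
by apply/funext => n; rewrite telescopeK /= subrK.
Qed.

Lemma cvgn_dist_le (K : numFieldType) (u : nat -> K) (l : K) :
  (forall e, 0 < e -> \forall n \near \oo, `|l - u n| <= e) ->
  cvg (u n @[n --> \oo]).
Proof. by move=> h; apply/cvg_ex; exists l; apply/cvgrPdist_le. Qed.

Lemma complex_geom_complete (R : realType) : geom_complete R[i].
Proof.
move=> u C r /andP[r0 r1] hu.
(* In the order on [R[i]] a nonnegative number is real, so [r], [C] and later [e] descend to [R],
   where the real and imaginary parts are treated separately. *)
have rE : r = (complex.Re r)%:C by rewrite RRe_real// ger0_real.
have C0 : 0 <= C by have := hu 0%N; rewrite expr0 mulr1; apply: le_trans.
have CE : C = (complex.Re C)%:C by rewrite RRe_real// ger0_real.
have hr : 0 <= complex.Re r < 1 by rewrite -lecR -ltcR -rE r0.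
have hb n : C * r ^+ n = (complex.Re C * complex.Re r ^+ n)%:C.
  by rewrite {1}CE {1}rE rmorphM rmorphXn.
have /cvg_ex[/= x hx] : cvg ((fun n => complex.Re (u n)) @ \oo).
  apply: (cvg_of_geom_increments (c := complex.Re C) hr) => n.
  rewrite -lecR -hb; apply: le_trans (hu n).
  by rewrite -raddfB; exact: normc_ge_Re.
have /cvg_ex[/= y hy] : cvg ((fun n => complex.Im (u n)) @ \oo).
  apply: (cvg_of_geom_increments (c := complex.Re C) hr) => n.
  rewrite -lecR -hb; apply: le_trans (hu n).
  by rewrite -raddfB; exact: normc_ge_Im.
apply: (@cvgn_dist_le _ u (x +i* y)) => e e0.
have eE : e = (complex.Re e)%:C by rewrite RRe_real// gtr0_real.
have e2 : 0 < complex.Re e / 2 by rewrite divr_gt0// -ltcR -eE.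
move: hx hy => /cvgrPdist_le /(_ _ e2) hx /cvgrPdist_le /(_ _ e2) hy.
near=> n; apply: (le_trans (norm_le_Re_Im _)).
rewrite eE lecR [leRHS](_ : _ = complex.Re e / 2 + complex.Re e / 2); last by field.
apply: lerD.
  have : `|x - complex.Re (u n)| <= complex.Re e / 2 by near: n.
  by case: (u n).
have : `|y - complex.Im (u n)| <= complex.Re e / 2 by near: n.
by case: (u n).
Unshelve. all: by end_near. Qed.

Theorem theorem4p6 (R : realType) (q : R[i]) (hq : 0 < `|q| < 1) :
  has_sum3
    (fun i j k : nat =>
       (-1) ^+ j
       * q ^ (i%:Z + j%:Z ^+ 2 + 2 * j%:Z + (i%:Z + j%:Z - k%:Z) ^+ 2)
       / (qpoch q q i * qpoch (q ^+ 2) (q ^+ 2) j * qpoch (q ^+ 2) (q ^+ 2) k))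
    (qpoch_inf (q ^+ 2) (q ^+ 2) * qpoch_inf (q ^+ 4) (q ^+ 4) ^+ 2
     / qpoch_inf q q ^+ 2)
  /\
  has_sum3
    (fun i j k : nat =>
       (-1) ^+ j
       * q ^ (j%:Z ^+ 2 + j%:Z + k%:Z)
       * (q ^ ((i%:Z + j%:Z - k%:Z) ^+ 2) + q ^ ((i%:Z + j%:Z - k%:Z + 1) ^+ 2))
       / (qpoch q q i * qpoch (q ^+ 2) (q ^+ 2) j * qpoch (q ^+ 2) (q ^+ 2) k))
    (qpoch_inf (q ^+ 2) (q ^+ 2) ^+ 7
     / (qpoch_inf q q ^+ 4 * qpoch_inf (q ^+ 4) (q ^+ 4) ^+ 2)).
Proof.
have cK := @complex_geom_complete R.
(* The fourth root of [|q|] that [has_sum3_conv] calls for. *)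
pose s := sqrtC (sqrtC `|q|).
have qs : `|q| = s ^+ 4 by rewrite (exprM s 2 2) !sqrtCK.
have s0 : 0 <= s by rewrite !sqrtC_ge0.
have /andP[_ q1] := hq.
have hs : 0 <= s < 1 by rewrite s0/= -(@expr_lt1 _ 4)// -qs.
by split; [exact: (has_sum3_theta1 cK hq hs qs)|exact: (has_sum3_theta2 cK hq hs qs)].
Qed.
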